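(* Let $\mathbb{F}$ be an algebraically closed field (of arbitrary characteristic), $F_n$ the free group on $n$ letters, and identify $R(F_n,\mathbb{F})=\mathrm{Hom}(F_n,\mathrm{SL}_2(\mathbb{F}))$ with $\mathrm{SL}_2(\mathbb{F})^n$. The closure-equivalence classes in $\mathrm{SL}_2(\mathbb{F})^n$ are precisely the (non-empty) fibres of the map $\mathrm{tr}_n\colon \mathrm{SL}_2(\mathbb{F})^n\to\mathbb{F}^d$. Hence the image of $\mathrm{tr}_n$ is naturally isomorphic with $X(F_n,\mathbb{F})=\mathrm{SL}_2(\mathbb{F})^n/\sim_c$ (via the bijection induced by $\mathrm{tr}_n$).
   Context: $\mathrm{SL}_2(\mathbb{F})^n\subset\mathbb{F}^{4n}$ carries the Zariski topology. $\mathrm{SL}_2(\mathbb{F})$ acts on $\mathrm{SL}_2(\mathbb{F})^n$ by simultaneous conjugation. Two tuples $A,B\in \mathrm{SL}_2(\mathbb{F})^n$ are closure-equivalent, $A\sim_c B$, if the Zariski closures of their orbits intersect. Here $d=n+\binom n2+\binom n3$ and $\mathrm{tr}_n(A_1,\ldots,A_n)=\big(\mathrm{tr}(A_{j_1}\cdots A_{j_m})\big)_{1\le j_1<\cdots<j_m\le n,\ 1\le m\le 3}\in\mathbb{F}^d$. The structure on the quotient set $X(F_n,\mathbb{F})$ (the variety of characters) is the one given by these trace coordinates. *)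

(* Defs.v *)
From HB Require Import structures.
From mathcomp Require Import all_boot all_order all_algebra.
From mathcomp Require Import mpoly.
From mathcomp Require Import boolp classical_sets functions.

Set Implicit Arguments.
Unset Strict Implicit.
Unset Printing Implicit Defensive.

Import GRing.Theory.
Local Open Scope classical_set_scope.
Local Open Scope ring_scope.

Definition SL2 (F : fieldType) : Type := {M : 'M[F]_2 | \det M == 1}.

Definition SL2n (F : fieldType) (n : nat) : Type := {ffun 'I_n -> SL2 F}.

(* The inclusion of SL_2(F)^n into the affine space F^(4n). *)
Definition coords (F : fieldType) (n : nat) (A : SL2n F n) :
    'rV[F]_(n * (2 * 2)) :=
  mxvec (\matrix_(i < n) mxvec (\val (A i))).

(* The topology induced on SL_2(F)^n by the Zariski topology of F^(4n): a
   closed set is the set of common zeros in SL_2(F)^n of a set of polynomials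
   in the 4n matrix entries. *)
Definition zariski_closed (F : fieldType) (n : nat) (Z : set (SL2n F n)) :
    Prop :=
  exists I : set {mpoly F[n * (2 * 2)]},
    Z = [set A | forall p, I p -> p.@[coords A 0] = 0].

Definition zariski_closure (F : fieldType) (n : nat) (S : set (SL2n F n)) :
    set (SL2n F n) :=
  smallest (@zariski_closed F n) S.

Definition conj_orbit (F : fieldType) (n : nat) (A : SL2n F n) :
    set (SL2n F n) :=
  [set B | exists g : SL2 F, forall i,
     \val (B i) = \val g *m \val (A i) *m invmx (\val g)].

Definition closure_equiv (F : fieldType) (n : nat) (A B : SL2n F n) : Prop :=
  zariski_closure (conj_orbit A) `&` zariski_closure (conj_orbit B) !=set0.

Definition closure_class (F : fieldType) (n : nat) (A : SL2n F n) :
    set (SL2n F n) :=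
  [set B | closure_equiv A B].

Definition closure_classes (F : fieldType) (n : nat) : set (set (SL2n F n)) :=
  range (@closure_class F n).

Arguments closure_classes : clear implicits.

(* The index set of the trace coordinates: the set {j_1 < ... < j_m} stands
   for the sequence (j_1, ..., j_m). *)
Definition trace_index (n : nat) : {set {set 'I_n}} :=
  [set J : {set 'I_n} | (0 < #|J| <= 3)%N]%SET.

Definition trace_dim (n : nat) : nat := (n + 'C(n, 2) + 'C(n, 3))%N.

Lemma card_trace_index (n : nat) : #|trace_index n| = trace_dim n.
Proof.
pose D k : {set {set 'I_n}} := [set J : {set 'I_n} | #|J| == k]%SET.
have cD k : #|D k| = 'C(n, k) by rewrite card_draws card_ord.
have dis k l : k != l -> #|D k :&: D l| = 0%N.
  move=> kl; apply/eqP; rewrite cards_eq0; apply/eqP/setP => J.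
  by rewrite !inE; apply/negP => /andP[/eqP-> /eqP E]; rewrite E eqxx in kl.
have -> : trace_index n = D 1%N :|: D 2 :|: D 3.
  by apply/setP => J; rewrite !inE; case: #|_| => [|[|[|[|]]]].
by rewrite !cardsU finset.setIUl cardsU !dis // !cD bin1 !subn0.
Qed.

(* The product over j in J runs through J in increasing order. *)
Definition trace_coord (F : fieldType) (n : nat) (A : SL2n F n)
    (J : {set 'I_n}) : F :=
  \tr (\prod_(j in J) \val (A j)).

Definition trn (F : fieldType) (n : nat) (A : SL2n F n) :
    'rV[F]_(trace_dim n) :=
  \row_k trace_coord A (enum_val (cast_ord (esym (card_trace_index n)) k)).

(* The quotient set X(F_n, F): its points are the closure-equivalence
   classes. *)
Definition char_variety (F : fieldType) (n : nat) : Type :=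
  set_type (closure_classes F n).

Definition char_of (F : fieldType) (n : nat) (A : SL2n F n) :
    char_variety F n :=
  exist _ (closure_class A) (mem_set (imageT (@closure_class F n) A)).

Definition trn_image (F : fieldType) (n : nat) : Type :=
  set_type (range (@trn F n)).

(* The structure on X(F_n, F) given by the trace coordinates: a regular
   function is a polynomial in the trace coordinates. *)
Definition char_regular (F : fieldType) (n : nat) (f : char_variety F n -> F) :
    Prop :=
  exists p : {mpoly F[trace_dim n]},
    forall A : SL2n F n, f (char_of A) = p.@[trn A 0].

(* A regular function on the image is the restriction of a polynomial
   function of F^d. *)
Definition image_regular (F : fieldType) (n : nat) (f : trn_image F n -> F) :
    Prop :=
  exists p : {mpoly F[trace_dim n]},
    forall y : trn_image F n, f y = p.@[\val y 0].

(* An isomorphism is a bijection such that it and its inverse both pull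
   regular functions back to regular functions. *)
Definition char_isomorphism (F : fieldType) (n : nat)
    (phi : char_variety F n -> trn_image F n) : Prop :=
  bijective phi /\
  forall f : trn_image F n -> F, image_regular f <-> char_regular (f \o phi).

(* Main.v *)
Require Import Defs.
From HB Require Import structures.
From mathcomp Require Import all_boot all_order all_algebra.
From mathcomp Require Import mpoly ring.
From mathcomp Require Import boolp classical_sets functions.

Set Implicit Arguments.
Unset Strict Implicit.
Unset Printing Implicit Defensive.

Import GRing.Theory.
Local Open Scope classical_set_scope.
Local Open Scope ring_scope.

(** Two tuples of SL_2 are closure-equivalent exactly when they have the same
    trace coordinates ([closure_equivP]); the three assertions of the theorem
    follow formally from this.

    The trace coordinates are polynomials in the entries that are constant on
    orbits, so they are constant on the closure of an orbit ([trn_closure]),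
    and closure-equivalent tuples have equal coordinates.

    Conversely, let [A] and [B] have equal trace coordinates. Cayley-Hamilton
    and the fundamental trace identity show that all products of at most three
    members, in any order and with repetitions, have equal traces
    ([trn_same_traces]). In characteristic 2 the traces of longer words in
    general matrices are not polynomials in these, so the argument does not go
    through the ring of all invariants but distinguishes two cases.

    If the members of [A] have no common eigenvector, then [A] and [B] are
    conjugate ([irreducible_conj]). A pair of matrices is irreducible exactly
    when its commutator is invertible, which is a condition on traces; an
    irreducible pair is conjugate to a normal form given by traces
    ([pair_normal_form]), and together with its product and the identity it
    spans all matrices, so that any other matrix is known from four traces
    ([pair_nondegenerate]). An irreducible tuple contains an irreducible pair
    of the form ([A i], [A j]) or ([A i], [A j * A k])
    ([irreducible_witness]). The latter form is needed for three matrices each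
    two of which share an eigenline, but not all three.

    If both tuples are triangularizable, conjugating by diagonal matrices
    contracts the off-diagonal entries to 0, so each orbit closure contains
    the diagonal part of the triangular form ([closure_diagonal]). The traces
    of single members and of products of two determine the diagonal parts up
    to a simultaneous swap of the two diagonal entries ([diagonal_traces]), so
    the two closures share a diagonal tuple. *)

(** * Two-by-two matrices by entries *)

Definition mx2 (F : fieldType) (a b c d : F) : 'M[F]_2 :=
  \matrix_(i, j) if i == 0 then (if j == 0 then a else b)
                 else (if j == 0 then c else d).

Variant mx2_spec (F : fieldType) : 'M[F]_2 -> Type :=
  Mx2Spec a b c d : mx2_spec (mx2 a b c d).

Lemma mx2_eq (F : fieldType) (M N : 'M[F]_2) :
  M 0 0 = N 0 0 -> M 0 1 = N 0 1 -> M 1 0 = N 1 0 -> M 1 1 = N 1 1 -> M = N.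
Proof.
move=> e1 e2 e3 e4; apply/matrixP => i j.
have o2 (k : 'I_2) : k = 0 \/ k = 1.
  by case: k => [[|[|//]]] ?; [left | right]; apply: val_inj.
by case: (o2 i) => ->; case: (o2 j) => ->.
Qed.

Lemma mx2P (F : fieldType) (M : 'M[F]_2) : mx2_spec M.
Proof.
suff -> : M = mx2 (M 0 0) (M 0 1) (M 1 0) (M 1 1) by constructor.
by apply: mx2_eq; rewrite mxE.
Qed.

Lemma mulmx2 (F : fieldType) (a b c d a' b' c' d' : F) :
  mx2 a b c d * mx2 a' b' c' d' =
  mx2 (a * a' + b * c') (a * b' + b * d') (c * a' + d * c') (c * b' + d * d').
Proof. by apply: mx2_eq; rewrite !mxE !big_ord_recl big_ord0 addr0 !mxE. Qed.

Lemma addmx2 (F : fieldType) (a b c d a' b' c' d' : F) :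
  mx2 a b c d + mx2 a' b' c' d' = mx2 (a + a') (b + b') (c + c') (d + d').
Proof. by apply: mx2_eq; rewrite !mxE. Qed.

Lemma oppmx2 (F : fieldType) (a b c d : F) :
  - mx2 a b c d = mx2 (- a) (- b) (- c) (- d).
Proof. by apply: mx2_eq; rewrite !mxE. Qed.

Lemma scalemx2 (F : fieldType) (x a b c d : F) :
  x *: mx2 a b c d = mx2 (x * a) (x * b) (x * c) (x * d).
Proof. by apply: mx2_eq; rewrite !mxE. Qed.

Lemma scalar_mx2 (F : fieldType) (x : F) : x%:M = mx2 x 0 0 x.
Proof. by apply: mx2_eq; rewrite !mxE. Qed.

Lemma trmx2 (F : fieldType) (a b c d : F) : \tr (mx2 a b c d) = a + d.
Proof. by rewrite /mxtrace !big_ord_recl big_ord0 addr0 !mxE. Qed.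

Lemma detmx2 (F : fieldType) (a b c d : F) : \det (mx2 a b c d) = a * d - b * c.
Proof.
rewrite (expand_det_row _ 0) !big_ord_recl big_ord0 addr0 /cofactor !det_mx11.
by rewrite !mxE /= expr0 expr1 mulN1r mulrN mul1r.
Qed.

Definition mx2E := (mulmx2, oppmx2, addmx2, scalemx2, trmx2, detmx2).

(** * Conjugation *)

Definition conjby (F : fieldType) (g M : 'M[F]_2) : 'M[F]_2 := g * M * g^-1.

Lemma conjbyE (F : fieldType) (g M N : 'M[F]_2) :
  g \is a GRing.unit -> g * M = N * g -> conjby g M = N.
Proof. by move=> ug e; rewrite /conjby e mulrK. Qed.

Lemma conjbyM (F : fieldType) (g M N : 'M[F]_2) :
  g \is a GRing.unit -> conjby g (M * N) = conjby g M * conjby g N.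
Proof. by move=> ug; rewrite /conjby !mulrA mulrVK. Qed.

Lemma conjbyB (F : fieldType) (g M N : 'M[F]_2) :
  conjby g (M - N) =
  conjby g M - conjby g N.
Proof. by rewrite /conjby mulrBr mulrBl. Qed.

Lemma conjby_comp (F : fieldType) (g h M : 'M[F]_2) :
  g \is a GRing.unit -> h \is a GRing.unit ->
  conjby h (conjby g M) = conjby (h * g) M.
Proof. by move=> ug uh; rewrite /conjby invrM // !mulrA. Qed.

Lemma conjbyK (F : fieldType) (g M : 'M[F]_2) :
  g \is a GRing.unit -> conjby g^-1 (conjby g M) = M.
Proof. by move=> ug; rewrite /conjby invrK !mulrA mulVr // mul1r mulrVK. Qed.

Lemma conjby_scalar (F : fieldType) (g : 'M[F]_2) (c : F) :
  g \is a GRing.unit -> conjby g c%:M = c%:M.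
Proof. by move=> ug; apply: conjbyE => //; exact: scalar_mxC. Qed.

Lemma tr_mulC (F : fieldType) (M N : 'M[F]_2) : \tr (M * N) = \tr (N * M).
Proof. exact: mxtrace_mulC. Qed.

Lemma tr_conjby (F : fieldType) (g M : 'M[F]_2) :
  g \is a GRing.unit -> \tr (conjby g M) = \tr M.
Proof. by move=> ug; rewrite /conjby tr_mulC mulrA mulVr // mul1r. Qed.

Lemma det_mul2 (F : fieldType) (M N : 'M[F]_2) :
  \det (M * N) = \det M * \det N.
Proof. exact: det_mulmx. Qed.

Lemma det_conjby (F : fieldType) (g M : 'M[F]_2) :
  g \is a GRing.unit -> \det (conjby g M) = \det M.
Proof.
move=> ug; rewrite /conjby det_mul2 mulrC -det_mul2 mulrA.
by rewrite mulVr // mul1r.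
Qed.

Lemma unit_mx2 (F : fieldType) (M : 'M[F]_2) :
  (M \is a GRing.unit) = (\det M != 0).
Proof. by rewrite -unitfE; exact: unitmxE. Qed.

(** * Pairs of matrices with invertible commutator *)

(** A pair of matrices over an algebraically closed field has a common
    eigenvector exactly when its commutator is singular, so this number is the
    obstruction to simultaneous triangularization of the pair. *)
Definition det_comm (F : fieldType) (P Q : 'M[F]_2) : F := \det (P * Q - Q * P).

(** Irreducibility of a pair is therefore visible on the traces: for
    determinants equal to 1 the right-hand side is 4 - x^2 - y^2 - z^2 + xyz,
    the classical 2 - tr [P, Q]. *)
Lemma det_comm_trace (F : fieldType) (P Q : 'M[F]_2) :
  det_comm P Q = 4%:R * \det P * \det Q
                 - \det Q * \tr P ^+ 2 - \det P * \tr Q ^+ 2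
                 - \tr (P * Q) ^+ 2 + \tr P * \tr Q * \tr (P * Q).
Proof.
rewrite /det_comm; case/mx2P: P => a b c d; case/mx2P: Q => p q r s.
by rewrite !mx2E; ring.
Qed.

Lemma det_comm_conjby (F : fieldType) (g P Q : 'M[F]_2) :
  g \is a GRing.unit -> det_comm (conjby g P) (conjby g Q) = det_comm P Q.
Proof. by move=> ug; rewrite /det_comm -!conjbyM // -conjbyB det_conjby. Qed.

Lemma det_comm_triangular (F : fieldType) (a b d p q r s : F) :
  det_comm (mx2 a b 0 d) (mx2 p q r s) =
  r * (q * (a - d) ^+ 2 - b ^+ 2 * r - b * (a - d) * (p - s)).
Proof. by rewrite /det_comm !mx2E; ring. Qed.

Lemma char_root (F : closedFieldType) (P : 'M[F]_2) :
  exists l : F, l ^+ 2 - \tr P * l + \det P = 0.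
Proof.
have [x] :=
  @solve_monicpoly F 2 (fun i => if i == 0%N then - \det P else \tr P) isT.
rewrite !big_ord_recl big_ord0 /= => e; exists x.
by rewrite e; ring.
Qed.

(** The eigenvalue [l] goes to the upper left corner when the second row of
    [g] is a row eigenvector of [P] for the other eigenvalue. *)
Lemma triangularize (F : fieldType) (P : 'M[F]_2) (l : F) :
  l ^+ 2 - \tr P * l + \det P = 0 ->
  exists g b, g \is a GRing.unit /\ conjby g P = mx2 l b 0 (\tr P - l).
Proof.
case/mx2P: P => a b c e; rewrite trmx2 detmx2 => Pl; set d := a + e - l.
have {}Pl : d ^+ 2 - (a + e) * d + (a * e - b * c) = 0 by rewrite -Pl /d; ring.
(* (x, y) is a row eigenvector for d, namely (c, d - a) if c != 0,
   (d - e, b) if b != 0, and a coordinate vector if P is diagonal. *)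
have [x [y [xy e1 e2]]] : exists x y : F, [/\ (x != 0) || (y != 0),
    x * a + y * c = d * x & x * b + y * e = d * y].
  have [c0 | c0] := eqVneq c 0; last first.
    exists c, (d - a); split; first by rewrite c0.
      by ring.
    by apply/eqP; rewrite -subr_eq0 -oppr_eq0 -[X in _ == X]Pl; apply/eqP; ring.
  have [b0 | b0] := eqVneq b 0; last first.
    exists (d - e), b; split; first by rewrite b0 orbT.
      by apply/eqP; rewrite -subr_eq0 -oppr_eq0 -[X in _ == X]Pl;
        apply/eqP; ring.
    by ring.
  have : (d - a) * (d - e) = 0 by rewrite -Pl b0; ring.
  move/eqP; rewrite mulf_eq0 !subr_eq0 => /orP[]/eqP->.
    by exists 1, 0; rewrite oner_neq0 b0; split=> //; ring.
  by exists 0, 1; rewrite oner_neq0 orbT c0; split=> //; ring.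
(* (z, t) is any first row that completes (x, y) to an invertible matrix. *)
have key (z t : F) : z * y - t * x != 0 ->
    exists g b', g \is a GRing.unit /\ conjby g (mx2 a b c e) = mx2 l b' 0 d.
  move=> Dn0; set D := _ - _ in Dn0.
  pose g := mx2 z t x y.
  have ug : g \is a GRing.unit by rewrite unit_mx2 detmx2.
  exists g, ((z * b + t * e) * (z / D) - (z * a + t * c) * (t / D)); split=> //.
  apply: conjbyE => //; rewrite /g !mx2E e1 e2 !mul0r !add0r.
  set N := (z * b + t * e) * z - (z * a + t * c) * t.
  have -> : (z * b + t * e) * (z / D) - (z * a + t * c) * (t / D) = N / D.
    by rewrite /N; field.
  move: e1 e2 => /eqP; rewrite -subr_eq0 => /eqP e1.
  move=> /eqP; rewrite -subr_eq0 => /eqP e2.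
  have lE : l = a + e - d by rewrite /d; ring.
  congr mx2; apply: (mulIf Dn0).
  - transitivity (l * z * D + N * x); last by field.
    apply/eqP; rewrite -subr_eq0 (_ : _ - _ =
      z * t * (x * a + y * c - d * x) - z ^+ 2 * (x * b + y * e - d * y)).
      by rewrite e1 e2 !mulr0 subrr.
    by rewrite lE /N /D; ring.
  - transitivity (l * t * D + N * y); last by field.
    apply/eqP; rewrite -subr_eq0 (_ : _ - _ =
      t ^+ 2 * (x * a + y * c - d * x) - z * t * (x * b + y * e - d * y)).
      by rewrite e1 e2 !mulr0 subrr.
    by rewrite lE /N /D; ring.
case/orP: xy => [x0 | y0].
- by apply: (key 0 (-1)); rewrite mul0r sub0r mulN1r opprK.
- by apply: (key 1 0); rewrite mul0r subr0 mul1r.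
Qed.

(** When the first basis vector is an eigenvector of [P], invertibility of the
    commutator makes it independent of its image under [Q]; in the basis
    formed by the two vectors, [Q] is a companion matrix and the only entry of
    [P] that is still free is read off from the trace of [P * Q]. *)
Lemma pair_normal_form (F : fieldType) (P Q : 'M[F]_2) (l : F) :
  det_comm P Q != 0 -> l ^+ 2 - \tr P * l + \det P = 0 ->
  exists g, [/\ g \is a GRing.unit,
    conjby g P = mx2 l (\tr (P * Q) - (\tr P - l) * \tr Q) 0 (\tr P - l) &
    conjby g Q = mx2 0 (- \det Q) 1 (\tr Q)].
Proof.
move=> D Pl; have [g [b [ug gP]]] := triangularize Pl.
move: D; rewrite -(det_comm_conjby P Q ug) -(tr_conjby (P * Q) ug).
rewrite -(tr_conjby Q ug) -(det_conjby Q ug) conjbyM // gP.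
move: (\tr P - l) gP => l' gP.
case/mx2P E: (conjby g Q) => [p q r s]; rewrite det_comm_triangular !mx2E.
rewrite mulf_eq0 negb_or => /andP[r0 _].
(* Up to a scalar, h is the inverse of the matrix with columns (1, 0) and
   (p, r), the first basis vector and its image under Q. *)
pose h := mx2 r (- p) 0 1.
have uh : h \is a GRing.unit by rewrite unit_mx2 detmx2 mulr0 subr0 mulr1.
exists (h * g); split; first by rewrite unitrMl.
- rewrite -conjby_comp // gP; apply: conjbyE => //.
  by rewrite /h !mx2E; congr mx2; ring.
- rewrite -conjby_comp // E; apply: conjbyE => //.
  by rewrite /h !mx2E; congr mx2; ring.
Qed.

(** Both pairs have the same normal form once one root [l] of their common
    characteristic polynomial has been chosen. *)
Lemma pair_conj (F : closedFieldType) (P Q P' Q' : 'M[F]_2) :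
  det_comm P Q != 0 -> \det P' = \det P -> \det Q' = \det Q ->
  \tr P' = \tr P -> \tr Q' = \tr Q -> \tr (P' * Q') = \tr (P * Q) ->
  exists g, [/\ g \is a GRing.unit, P' = conjby g P & Q' = conjby g Q].
Proof.
move=> D dP dQ tP tQ tPQ.
have D' : det_comm P' Q' != 0.
  by rewrite det_comm_trace dP dQ tP tQ tPQ -det_comm_trace.
have [l Pl] := char_root P.
have Pl' : l ^+ 2 - \tr P' * l + \det P' = 0 by rewrite tP dP.
have [g [ug gP gQ]] := pair_normal_form D Pl.
have [h [uh hP hQ]] := pair_normal_form D' Pl'.
exists (h^-1 * g); split; first by rewrite unitrMl ?unitrV.
- by rewrite -conjby_comp ?unitrV // gP -(conjbyK P' uh) hP tP tQ tPQ.
- by rewrite -conjby_comp ?unitrV // gQ -(conjbyK Q' uh) hQ dQ tQ.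
Qed.

Lemma conjby_eq0 (F : fieldType) (g M : 'M[F]_2) :
  g \is a GRing.unit -> conjby g M = 0 -> M = 0.
Proof. by move=> ug e; rewrite -(conjbyK M ug) e /conjby mulr0 mul0r. Qed.

(** This says that 1, [P], [Q], [P * Q] form a basis of the matrix algebra,
    which is paired with itself by the trace form. Hence a matrix is
    determined by its traces against these four. In normal form the four
    conditions reduce to a linear system whose determinant is that of the
    commutator. *)
Lemma pair_nondegenerate (F : closedFieldType) (P Q M : 'M[F]_2) :
  det_comm P Q != 0 -> \tr M = 0 -> \tr (M * P) = 0 -> \tr (M * Q) = 0 ->
  \tr (M * (P * Q)) = 0 -> M = 0.
Proof.
move=> D; have [l Pl] := char_root P.
have [g [ug gP gQ]] := pair_normal_form D Pl.
move: D; rewrite -(det_comm_conjby _ _ ug) -(tr_conjby M ug).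
rewrite -(tr_conjby (M * P) ug) -(tr_conjby (M * Q) ug).
rewrite -(tr_conjby (M * _) ug) !conjbyM //.
rewrite gP gQ det_comm_triangular.
move: (\tr (P * Q) - (\tr P - l) * \tr Q) => a.
move: (\tr P - l) (\det Q) (\tr Q) => l' e t D m1 m2 m3 m4.
apply: (conjby_eq0 ug); case/mx2P: (conjby g M) m1 m2 m3 m4 => p q r s.
rewrite !mx2E.
move=> /eqP; rewrite addrC addr_eq0 => /eqP-> m2 m3 m4.
have qE : q = e * r + p * t.
  by rewrite -[LHS](subr0) -m3; ring.
have e1 : (l - l') * p + a * r = 0 by rewrite -m2; ring.
have e2 : a * p + (a * t - e * (l - l')) * r = 0 by rewrite -m4 qE; ring.
have r0 : r = 0.
  apply: (mulfI D); rewrite mulr0.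
  transitivity ((l - l') * (a * p + (a * t - e * (l - l')) * r)
                - a * ((l - l') * p + a * r)); first ring.
  by rewrite e1 e2 !mulr0 subrr.
have p0 : p = 0.
  apply: (mulfI D); rewrite mulr0.
  transitivity ((a * t - e * (l - l')) * ((l - l') * p + a * r)
                - a * (a * p + (a * t - e * (l - l')) * r)); first ring.
  by rewrite e1 e2 !mulr0 subrr.
by rewrite qE r0 p0 mulr0 mul0r addr0 oppr0; apply: mx2_eq; rewrite !mxE.
Qed.

(** * Families without common eigenvector *)

Definition triangularizable (F : fieldType) (T : Type) (A : T -> 'M[F]_2) :=
  exists2 g, g \is a GRing.unit & forall i, conjby g (A i) 1 0 = 0.

Lemma det_comm_diagonal (F : fieldType) (a d p q r s : F) :
  det_comm (mx2 a 0 0 d) (mx2 p q r s) = r * q * (a - d) ^+ 2.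
Proof. by rewrite det_comm_triangular; ring. Qed.

(** Suppose that all commutators of pairs are singular, and conjugate so that
    some non-scalar [A i] is upper triangular. If it has a single eigenline,
    singular commutators force every matrix of the family to fix that line.
    Otherwise make it diagonal: every other matrix then fixes one of the two
    axes, so it is upper or lower triangular. If neither axis is fixed by all,
    some [A j] is lower and some [A k] upper triangular, neither of them
    diagonal, and then [A j * A k] fixes no axis, while 1, [A i], [A j],
    [A k] span the matrices. *)
Lemma irreducible_witness (F : closedFieldType) (T : Type) (A : T -> 'M[F]_2) :
  (forall i, \det (A i) != 0) -> ~ triangularizable A ->
  (exists i j, det_comm (A i) (A j) != 0) \/
  (exists i j k, det_comm (A i) (A j * A k) != 0 /\
     forall M, \tr M = 0 -> \tr (M * A i) = 0 -> \tr (M * A j) = 0 ->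
       \tr (M * A k) = 0 -> M = 0).
Proof.
move=> dA irr; apply: contrapT => /not_orP[pairs triples].
have {}pairs i j : det_comm (A i) (A j) = 0.
  by apply: contrapT => /eqP D; apply: pairs; exists i, j.
have lower_entry g : g \is a GRing.unit -> exists i, conjby g (A i) 1 0 != 0.
  move=> ug; apply: contrapT => no; apply: irr; exists g => // i.
  by apply: contrapT => /eqP ni; apply: no; exists i.
have [i0 ns] : exists i, forall c, A i <> c%:M.
  apply: contrapT => no; have [i] := lower_entry 1 (unitr1 _).
  rewrite /conjby mul1r invr1 mulr1; apply/negP; rewrite negbK; apply/eqP.
  apply: contrapT => ni; apply: no; exists i => c e; apply: ni.
  by rewrite e scalar_mx2 mxE.
have [l Pl] := char_root (A i0).
have [g [b [ug]]] := triangularize Pl; move: (_ - l) => d {Pl} gA.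
have [ld | ld] := eqVneq l d.
  have [j] := lower_entry g ug; have := pairs i0 j.
  rewrite -(det_comm_conjby _ _ ug) gA ld;
    case/mx2P: (conjby g (A j)) => p q r s.
  rewrite det_comm_triangular mxE /= => D rn0; move/eqP: D.
  rewrite subrr expr0n /= !(mulr0, mul0r) sub0r subr0 mulf_eq0 (negbTE rn0) /=.
  rewrite oppr_eq0 mulf_eq0 (negbTE rn0) orbF expf_eq0 /= => /eqP b0.
  by case: (ns d); rewrite -(conjbyK (A i0) ug) gA ld b0 -scalar_mx2
    conjby_scalar ?unitrV.
(* This h diagonalizes mx2 l b 0 d. *)
pose h := mx2 1 (b / (l - d)) 0 1.
have uh : h \is a GRing.unit.
  by rewrite unit_mx2 detmx2 mulr0 subr0 mulr1 oner_neq0.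
have {gA} gA : conjby (h * g) (A i0) = mx2 l 0 0 d.
  rewrite -conjby_comp // gA; apply: conjbyE => //; rewrite /h !mx2E.
  by congr mx2; try ring; field; rewrite subr_eq0.
have {}ug : h * g \is a GRing.unit by rewrite unitrMl.
move: (h * g) gA ug => {uh} {}g {h} gA ug.
pose w : 'M[F]_2 := mx2 0 1 1 0.
have uw : w \is a GRing.unit.
  by rewrite unit_mx2 detmx2 mulr0 sub0r mulr1 oppr_eq0 oner_neq0.
have cjw p q r s : conjby w (mx2 p q r s) = mx2 s r q p.
  by apply: conjbyE => //; rewrite !mx2E; congr mx2; ring.
have [j jn0] := lower_entry g ug.
have [k] := lower_entry (w * g) ltac:(by rewrite unitrMl).
rewrite -conjby_comp //.
move=> kn0; apply: triples; exists i0, j, k.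
have := pairs i0 j; have := pairs i0 k.
rewrite -(det_comm_conjby (A i0) (A j) ug) -(det_comm_conjby (A i0) (A k) ug)
  gA.
have := dA j; have := dA k;
  rewrite -(det_conjby (A j) ug) -(det_conjby (A k) ug).
rewrite -(det_comm_conjby _ (A j * A k) ug) conjbyM // gA.
have trE M N : \tr (M * N) = \tr (conjby g M * conjby g N).
  by rewrite -conjbyM // tr_conjby.
case/mx2P: (conjby g (A j)) (trE ^~ (A j)) jn0 => p q r s tj;
  rewrite mxE /= => r0.
case/mx2P: (conjby g (A k)) (trE ^~ (A k)) kn0 => p' q' r' s' tk.
rewrite cjw mxE /= => q'0; rewrite !detmx2 !det_comm_diagonal => dk dj.
move=> /eqP; rewrite mulf_eq0 expf_eq0 subr_eq0 (negbTE ld) orbF.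
rewrite mulf_eq0 (negbTE q'0) orbF => /eqP r'0.
move=> /eqP; rewrite mulf_eq0 expf_eq0 subr_eq0 (negbTE ld) orbF.
rewrite mulf_eq0 (negbTE r0) /= => /eqP q0.
have [p0 p'0] : p != 0 /\ p' != 0.
  split; first by apply: contraNneq dj => ->; rewrite q0 !mul0r subrr.
  by apply: contraNneq dk => ->; rewrite r'0 mul0r mulr0 subrr.
split.
  rewrite mulmx2 det_comm_diagonal q0 r'0 !mulf_neq0 ?expf_neq0 ?subr_eq0 //.
    by rewrite mulr0 addr0 mulf_neq0.
  by rewrite mul0r addr0 mulf_neq0.
move=> M m0; rewrite trE tj tk gA => mi mj mk; apply: (conjby_eq0 ug).
move: m0; rewrite -(tr_conjby M ug);
  case/mx2P: (conjby g M) mi mj mk => a b' c e.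
rewrite !mx2E q0 r'0 => mi mj mk /eqP; rewrite addrC addr_eq0 => /eqP eE.
have a0 : a = 0.
  have ld0 : l - d != 0 by rewrite subr_eq0.
  by apply: (mulIf ld0); rewrite mul0r -mi eE; ring.
have b'0 : b' = 0 by apply: (mulIf r0); rewrite mul0r -mj eE a0; ring.
have c0 : c = 0 by apply: (mulIf q'0); rewrite mul0r -mk eE a0; ring.
by rewrite eE a0 b'0 c0 oppr0; apply: mx2_eq; rewrite !mxE.
Qed.

(** * Irreducible families are determined by their traces *)

(** The indices are arbitrary here, unlike in the trace coordinates, where
    they increase strictly: this makes the condition usable without case
    distinctions on the order and on the repetitions of indices. *)
Definition same_traces (F : fieldType) (T : Type) (A B : T -> 'M[F]_2) :=
  [/\ forall i, \tr (B i) = \tr (A i),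
      forall i j, \tr (B i * B j) = \tr (A i * A j) &
      forall i j k, \tr (B i * B j * B k) = \tr (A i * A j * A k)].

(** Cayley-Hamilton for XY with one factor Y cancelled reads
    XYX = tr(XY) X - det(X) (tr(Y) - Y). *)
Lemma tr_sandwich (F : fieldType) (X Y Z : 'M[F]_2) :
  \tr (X * Y * X * Z) =
  \tr (X * Y) * \tr (X * Z) - \det X * (\tr Y * \tr Z - \tr (Y * Z)).
Proof.
case/mx2P: X => a b c d; case/mx2P: Y => a' b' c' d'.
by case/mx2P: Z => a'' b'' c'' d''; rewrite !mx2E; ring.
Qed.

Lemma tr_square (F : fieldType) (X Y : 'M[F]_2) :
  \tr (X * X * Y) = \tr X * \tr (X * Y) - \det X * \tr Y.
Proof.
by case/mx2P: X => a b c d; case/mx2P: Y => a' b' c' d'; rewrite !mx2E; ring.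
Qed.

(** The two cyclic orders of three factors are exchanged by the fundamental
    trace identity, which is valid over the integers; so either of them
    determines the other in any characteristic. *)
Lemma tr_swap (F : fieldType) (X Y Z : 'M[F]_2) :
  \tr (X * Z * Y) = \tr X * \tr (Y * Z) + \tr Y * \tr (X * Z) +
    \tr Z * \tr (X * Y) - \tr X * \tr Y * \tr Z - \tr (X * Y * Z).
Proof.
case/mx2P: X => a b c d; case/mx2P: Y => a' b' c' d'.
by case/mx2P: Z => a'' b'' c'' d''; rewrite !mx2E; ring.
Qed.

(** Choose a conjugating matrix for a pair with invertible commutator; the
    other members follow, because each of them is determined by its traces
    against a basis of the matrices. In the exceptional case, where that pair
    is ([A i], [A j * A k]), the traces of [A j] against the basis of the pair
    involve a word of length four with a repeated letter, which [tr_sandwich]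
    reduces; this settles [A j], then [A k], and all the others by their
    traces against 1, [A i], [A j], [A k]. No word in four distinct letters
    occurs: in characteristic 2 the trace of a product of four general
    matrices is not a polynomial in the shorter traces. *)
Lemma irreducible_conj (F : closedFieldType) (T : Type) (A B : T -> 'M[F]_2) :
  (forall i, \det (A i) = 1) -> (forall i, \det (B i) = 1) ->
  same_traces A B -> ~ triangularizable A ->
  exists2 g, g \is a GRing.unit & forall i, B i = conjby g (A i).
Proof.
move=> dA dB [t1 t2 t3] /irreducible_witness.
case=> [i|[i [j D]]|[i [j [k [D basis]]]]]; first by rewrite dA oner_neq0.
- have [g [ug Bi Bj]] := pair_conj D (etrans (dB i) (esym (dA i)))
    (etrans (dB j) (esym (dA j))) (t1 i) (t1 j) (t2 i j).
  exists g => // k; apply/eqP; rewrite -subr_eq0; apply/eqP.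
  apply: (@pair_nondegenerate _ (B i) (B j)).
  + by rewrite Bi Bj det_comm_conjby.
  + by rewrite raddfB /= tr_conjby // t1 subrr.
  + by rewrite mulrBl raddfB /= {2}Bi -conjbyM // tr_conjby // t2 subrr.
  + by rewrite mulrBl raddfB /= {2}Bj -conjbyM // tr_conjby // t2 subrr.
  + by rewrite mulrBl raddfB /= mulrA t3 Bi Bj -!conjbyM // tr_conjby // mulrA
      subrr.
- have tjk : \tr (B i * (B j * B k)) = \tr (A i * (A j * A k)).
    by rewrite !mulrA t3.
  have djk : \det (B j * B k) = \det (A j * A k) by rewrite !det_mul2 !dA !dB.
  have [g [ug Bi Bjk]] :=
    pair_conj D (etrans (dB i) (esym (dA i))) djk (t1 i) (t2 j k) tjk.
  have Bj : B j = conjby g (A j).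
    apply/eqP; rewrite -subr_eq0; apply/eqP.
    apply: (@pair_nondegenerate _ (B i) (B j * B k)).
    + by rewrite Bi Bjk det_comm_conjby.
    + by rewrite raddfB /= tr_conjby // t1 subrr.
    + by rewrite mulrBl raddfB /= {2}Bi -conjbyM // tr_conjby // t2 subrr.
    + by rewrite mulrBl raddfB /= {2}Bjk -conjbyM // tr_conjby // !mulrA t3
        subrr.
    + rewrite mulrBl raddfB /= {2}Bi {2}Bjk -!conjbyM // tr_conjby // !mulrA.
      by rewrite !tr_sandwich dA dB !t1 !t2 subrr.
  have Bk : B k = conjby g (A k).
    have uBj : B j \is a GRing.unit by rewrite unit_mx2 dB oner_neq0.
    by apply: (mulrI uBj); rewrite Bjk conjbyM // -Bj.
  exists g => // l; apply/eqP; rewrite -subr_eq0; apply/eqP.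
  apply: (conjby_eq0 (g := g^-1)); first by rewrite unitrV.
  rewrite conjbyB conjbyK //;
    have ug' : g^-1 \is a GRing.unit by rewrite unitrV.
  apply: basis; first by rewrite raddfB /= tr_conjby // t1 subrr.
  all: rewrite mulrBl raddfB /=.
  + by rewrite -{1}(conjbyK (A i) ug) -Bi -conjbyM // tr_conjby // t2 subrr.
  + by rewrite -{1}(conjbyK (A j) ug) -Bj -conjbyM // tr_conjby // t2 subrr.
  + by rewrite -{1}(conjbyK (A k) ug) -Bk -conjbyM // tr_conjby // t2 subrr.
Qed.

(** * Triangularizable families *)

(** A diagonal matrix of determinant 1 is determined by its trace up to
    swapping its entries. The traces of products force the same choice at all
    indices: an index [i0] with [a i0 != d i0] makes the trace and the trace
    of the product with index [i0] two independent linear conditions on the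
    entries. *)
Lemma diagonal_traces (F : fieldType) (T : Type) (a d a' d' : T -> F) :
  (forall i, a i * d i = 1) -> (forall i, a' i * d' i = 1) ->
  (forall i, a' i + d' i = a i + d i) ->
  (forall i j, a' i * a' j + d' i * d' j = a i * a j + d i * d j) ->
  (forall i, a' i = a i) \/ (forall i, d' i = a i).
Proof.
move=> n n' t1 t2.
have root i : (a' i - a i) * (a' i - d i) = 0.
  transitivity (a' i ^+ 2 - a' i * (a i + d i) + a i * d i); first ring.
  by rewrite -t1 n -(n' i); ring.
have [[i0 ad] | eqad] := pselect (exists i, a i != d i); last first.
  left=> i; have [e | /eqP ne] := pselect (a i = d i).
    have := root i; rewrite -e => /eqP; rewrite mulf_eq0 orbb subr_eq0.
    by move/eqP.
  by case: eqad; exists i.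
(* The determinant of this system in (x, y) is a i0 - d i0, up to sign. *)
have solve (x y : F) k : x + y = a k + d k ->
    a i0 * x + d i0 * y = a i0 * a k + d i0 * d k -> x = a k.
  move=> e1 e2; have ad0 : a i0 - d i0 != 0 by rewrite subr_eq0.
  apply: (mulfI ad0); transitivity
    ((a i0 * x + d i0 * y) - d i0 * (x + y)); first ring.
  by rewrite e1 e2; ring.
move/eqP: (root i0); rewrite mulf_eq0 !subr_eq0 => /orP[/eqP e | /eqP e].
- left=> k; apply: (solve _ (d' k)) => //; rewrite -t2 e; congr (_ + _ * _).
  by apply: (addrI (a i0)); rewrite -{2}e t1.
- right=> k; apply: (solve _ (a' k)); first by rewrite addrC t1.
  rewrite -t2 e addrC; congr (_ + _ * _).
  by apply: (addrI (d i0)); rewrite -{2}e t1 addrC.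
Qed.

(** A swap of the two diagonal sequences is undone by conjugating with the
    antidiagonal permutation matrix, which turns upper triangular matrices
    into lower triangular ones; hence the two shapes for [B]. *)
Lemma triangularizable_common_diagonal (F : fieldType) (T : Type)
    (A B : T -> 'M[F]_2) :
  (forall i, \det (A i) = 1) -> (forall i, \det (B i) = 1) ->
  same_traces A B -> triangularizable A -> triangularizable B ->
  exists (a d : T -> F), [/\ forall i, a i * d i = 1,
    exists2 g, g \is a GRing.unit &
      exists b, forall i, conjby g (A i) = mx2 (a i) (b i) 0 (d i) &
    exists2 g, g \is a GRing.unit &
      (exists b, forall i, conjby g (B i) = mx2 (a i) (b i) 0 (d i)) \/
      (exists c, forall i, conjby g (B i) = mx2 (a i) 0 (c i) (d i))].
Proof.
have tri (C : T -> 'M[F]_2) : (forall i, \det (C i) = 1) ->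
    triangularizable C ->
    exists2 g, g \is a GRing.unit & exists a b d : T -> F,
      (forall i, a i * d i = 1) /\
      (forall i, conjby g (C i) = mx2 (a i) (b i) 0 (d i)).
  move=> dC [g ug gC]; exists g => //.
  exists (fun i => conjby g (C i) 0 0), (fun i => conjby g (C i) 0 1).
  exists (fun i => conjby g (C i) 1 1).
  have E i : conjby g (C i) =
      mx2 (conjby g (C i) 0 0) (conjby g (C i) 0 1) 0 (conjby g (C i) 1 1).
    by apply: mx2_eq; rewrite [RHS]mxE ?gC.
  split=> // i; have := det_conjby (C i) ug.
  by rewrite {1}E detmx2 mulr0 subr0 dC.
move=> dA dB [t1 t2 _] /tri-/(_ dA)[g ug [a [b [d [n gA]]]]].
move=> /tri-/(_ dB)[h uh [a' [b' [d' [n' hB]]]]].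
have [||e|e] := diagonal_traces n n'.
- by move=> i; have := t1 i;
    rewrite -(tr_conjby (A i) ug) -(tr_conjby (B i) uh) gA hB !trmx2.
- move=> i j; have := t2 i j;
    rewrite -(tr_conjby (A i * _) ug) -(tr_conjby (B i * _) uh).
  by rewrite !conjbyM // !gA !hB !mx2E !(mulr0, mul0r, add0r, addr0).
- have e' i : d' i = d i.
    have := n' i; rewrite e -(n i) => /mulfI; apply.
    by apply/eqP => a0; have/eqP := n i; rewrite a0 mul0r eq_sym oner_eq0.
  exists a, d; split=> //; first by exists g => //; exists b.
  by exists h => //; left; exists b' => i; rewrite hB e e'.
- have e' i : a' i = d i.
    have := n' i; rewrite e -(n i) mulrC => /mulfI; apply.
    by apply/eqP => a0; have/eqP := n i; rewrite a0 mul0r eq_sym oner_eq0.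
  exists a, d; split=> //; first by exists g => //; exists b.
  pose w : 'M[F]_2 := mx2 0 1 1 0.
  have uw : w \is a GRing.unit.
    by rewrite unit_mx2 detmx2 mulr0 sub0r mulr1 oppr_eq0 oner_neq0.
  exists (w * h); first by rewrite unitrMl.
  right; exists b' => i; rewrite -conjby_comp // hB; apply: conjbyE => //.
  by rewrite !mx2E e e'; congr mx2; ring.
Qed.

(** * Trace coordinates *)

Definition mats (F : fieldType) (n : nat) (A : SL2n F n) : 'I_n -> 'M[F]_2 :=
  fun i => \val (A i).

Lemma det_mats (F : fieldType) (n : nat) (A : SL2n F n) i : \det (mats A i) = 1.
Proof. exact/eqP/(valP (A i)). Qed.

Lemma trace_coord_trn (F : fieldType) (n : nat) (A B : SL2n F n) :
  trn A = trn B <->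
  forall J, J \in trace_index n -> trace_coord A J = trace_coord B J.
Proof.
split=> [e J Jt | e].
  move/matrixP/(_ 0 (cast_ord (card_trace_index n) (enum_rank_in Jt J))): e.
  by rewrite !mxE cast_ordK enum_rankK_in.
apply/rowP => k; rewrite !mxE; apply: e.
exact: enum_valP.
Qed.

(** The arrangement [r] of the letters is the one in which a trace coordinate
    multiplies them. It is left unspecified: what matters is that it is the
    same for both tuples. *)
Lemma trn_word (F : fieldType) (n : nat) (A B : SL2n F n) (s : seq 'I_n) :
  trn A = trn B -> uniq s -> (0 < size s <= 3)%N ->
  exists2 r, perm_eq r s &
    \tr (\prod_(j <- r) mats B j) = \tr (\prod_(j <- r) mats A j).
Proof.
move=> /trace_coord_trn AB us ss; pose J := [set x in s]%SET.
exists [seq j <- index_enum 'I_n | j \in J].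
  apply: uniq_perm => //; first by rewrite filter_uniq ?index_enum_uniq.
  by move=> x; rewrite mem_filter mem_index_enum andbT inE.
by rewrite !big_filter; apply/esym/AB; rewrite inE cardsE (card_uniqP us).
Qed.

(** Repetitions are removed by the Cayley-Hamilton theorem, and a triple of
    distinct indices is, up to rotation, either in the order of a coordinate
    or in the opposite one. *)
Lemma trn_same_traces (F : fieldType) (n : nat) (A B : SL2n F n) :
  trn A = trn B -> same_traces (mats A) (mats B).
Proof.
move=> AB.
have t1 i : \tr (mats B i) = \tr (mats A i).
  have [//|r] := trn_word (s := [:: i]) AB isT.
  move/[dup]/perm_size; case: r => [|x [|//]] // _ /perm_mem/(_ i).
  by rewrite !inE eqxx => /eqP->; rewrite !big_seq1.
have sq X : \det X = 1 -> X * X = \tr X *: X - 1 :> 'M[F]_2.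
  case/mx2P: X => a b c d dX.
  by rewrite (_ : 1 = (1 : F)%:M) // -dX scalar_mx2 !mx2E; congr mx2; ring.
have t2 i j : \tr (mats B i * mats B j) = \tr (mats A i * mats A j).
  have [<- | ij] := eqVneq i j.
    by rewrite !sq ?det_mats // !raddfB /= !linearZ /= t1.
  have [|//|r] := trn_word (s := [:: i; j]) AB; first by rewrite /= inE ij.
  move/[dup]/perm_size; case: r => [|x [|y [|//]]] // _ /perm_mem xy.
  rewrite !big_cons !big_nil !mulr1 => e.
  have := xy i; have := xy j; rewrite !inE !eqxx orbT.
  move=> /orP[]/eqP ej /orP[]/eqP ei; move: ij; rewrite ei ej ?eqxx // => _.
  by rewrite tr_mulC e tr_mulC.
have rot (C : SL2n F n) x y z :
    \tr (mats C y * mats C z * mats C x) = \tr (mats C x * mats C y * mats C z).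
  by rewrite tr_mulC mulrA.
split=> // i j k.
have [<- | ij] := eqVneq i j; first by rewrite !tr_square !det_mats !t1 t2.
have [<- | jk] := eqVneq j k.
  by rewrite -!(rot _ i) !tr_square !det_mats !t1 t2.
have [<- | ik] := eqVneq i k.
  by rewrite !(rot _ i i j) !tr_square !det_mats !t1 t2.
have [|//|r] := trn_word (s := [:: i; j; k]) AB.
  by rewrite /= !inE negb_or ij ik jk.
move/[dup]/perm_size; case: r => [|x [|y [|z [|//]]]] // _ /perm_mem xyz.
rewrite !big_cons !big_nil !mulr1 !mulrA => e.
have e' : \tr (mats B x * mats B z * mats B y) =
          \tr (mats A x * mats A z * mats A y).
  by rewrite [LHS]tr_swap [RHS]tr_swap e !t1 !t2.
(* Rotations to the orders x y z and x z y. *)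
pose cyc C :=
  (rot C x y z, esym (rot C z x y), rot C x z y, esym (rot C y x z)).
have := xyz i; have := xyz j; have := xyz k; rewrite !inE !eqxx !orbT.
move=> /or3P[]/eqP ek /or3P[]/eqP ej /or3P[]/eqP ei;
   move: ij ik jk; rewrite ei ej ek ?eqxx // => _ _ _.
all: by rewrite ?(cyc A) ?(cyc B) ?e ?e'.
Qed.

(** * Orbits and their closures *)

(** Over an algebraically closed field an invertible matrix can be rescaled to
    determinant 1, and scalars do not change conjugation. *)
Lemma SL2_representative (F : closedFieldType) (g : 'M[F]_2) :
  g \is a GRing.unit ->
  exists h : SL2 F, forall M, \val h *m M *m invmx (\val h) = conjby g M.
Proof.
move=> ug; have dg : \det g != 0 by rewrite -unit_mx2.
have [c] :=
  @solve_monicpoly F 2 (fun i => if i == 0%N then (\det g)^-1 else 0) isT.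
rewrite !big_ord_recl big_ord0 /= mul0r !addr0 expr0 mulr1 => c2.
have dcg : \det (c *: g) == 1 by rewrite detZ c2 mulVf.
exists (exist _ (c *: g) dcg) => M; apply: (@conjbyE _ (c *: g)).
  by rewrite unit_mx2 (eqP dcg) oner_neq0.
by rewrite -scalerAl -scalerAr /conjby mulrVK.
Qed.

Lemma conj_orbitP (F : closedFieldType) (n : nat) (A B : SL2n F n) :
  conj_orbit A B <->
  exists2 g, g \is a GRing.unit & forall i, mats B i = conjby g (mats A i).
Proof.
split=> [[g AB] | [g ug AB]].
  exists (\val g) => //; rewrite unit_mx2.
  by have /eqP-> := valP g; rewrite oner_neq0.
by have [h hg] := SL2_representative ug; exists h => i; rewrite hg -AB.
Qed.

Lemma trn_orbit (F : closedFieldType) (n : nat) (A B : SL2n F n) :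
  conj_orbit A B -> trn B = trn A.
Proof.
move=> /conj_orbitP[g ug AB]; apply/trace_coord_trn => J _.
rewrite /trace_coord -[RHS](tr_conjby _ ug).
rewrite (big_morph (conjby g) (fun x y => conjbyM x y ug) (id1 := 1));
  last first.
  by rewrite /conjby mulr1 mulrV.
by congr (\tr _); apply: eq_bigr => j _; exact: AB.
Qed.

(** The trace coordinate as a polynomial in the matrix entries: the same
    product formed with generic matrices. *)
Definition trace_poly (F : fieldType) (n : nat) (J : {set 'I_n}) :
    {mpoly F[n * (2 * 2)]} :=
  \tr (\prod_(j in J) \matrix_(a < 2, b < 2)
         'X_(mxvec_index j (mxvec_index a b))).

Lemma trace_polyE (F : fieldType) (n : nat) (A : SL2n F n) (J : {set 'I_n}) :
  (trace_poly F J).@[coords A 0] = trace_coord A J.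
Proof.
rewrite /trace_poly -trace_map_mx rmorph_prod; congr (\tr _).
apply: eq_bigr => j _; apply/matrixP => a b.
rewrite !mxE /=.
by rewrite mevalXU /coords mxvecE mxE mxvecE.
Qed.

Lemma trn_fibre_closed (F : fieldType) (n : nat) (t : 'rV[F]_(trace_dim n)) :
  zariski_closed (@trn F n @^-1` [set t]).
Proof.
pose J k := enum_val (cast_ord (esym (card_trace_index n)) k).
exists [set p | exists k, p = trace_poly F (J k) - (t 0 k)%:MP].
apply/seteqP; split=> A /=.
  move=> <- p [k ->]; rewrite mevalB mevalC trace_polyE mxE; exact: subrr.
move=> At; apply/rowP => k; apply/eqP; rewrite -subr_eq0.
have := At _ (ex_intro _ k erefl).
by rewrite mevalB mevalC trace_polyE => <-; rewrite mxE.
Qed.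

Lemma trn_closure (F : closedFieldType) (n : nat) (A B : SL2n F n) :
  zariski_closure (conj_orbit A) B -> trn B = trn A.
Proof.
move/(_ (@trn F n @^-1` [set trn A])); apply.
by split; [exact: trn_fibre_closed | move=> C /trn_orbit].
Qed.

Lemma orbit_closure (F : fieldType) (n : nat) (A B : SL2n F n) :
  conj_orbit A B -> zariski_closure (conj_orbit A) B.
Proof. by move=> AB Z [_]; exact. Qed.

Lemma meval_line (F : fieldType) (m : nat) (u v : 'I_m -> F)
    (p : {mpoly F[m]}) :
  exists q : {poly F}, forall s, q.[s] = p.@[fun i => u i + s * v i].
Proof.
elim/mpolyind: p => [|c k p _ _ [q qE]].
  by exists 0 => s; rewrite horner0 meval0.
exists (c *: (\prod_i ((u i)%:P + v i *: 'X) ^+ k i) + q) => s.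
rewrite hornerD hornerZ horner_prod mevalD mevalZ mevalX qE.
congr (_ * _ + _); apply: eq_bigr => i _.
by rewrite horner_exp hornerD hornerC hornerZ hornerX mulrC.
Qed.

(** If [q] is nonzero, then [q * 'X + 1] is not constant, but it has no root. *)
Lemma horner_vanish0 (F : closedFieldType) (q : {poly F}) :
  (forall s, s != 0 -> q.[s] = 0) -> q.[0] = 0.
Proof.
move=> q0; have [-> | qn0] := eqVneq q 0; first by rewrite horner0.
have /closed_rootP[x] : size (q * 'X + 1%:P) != 1.
  by rewrite size_MXaddC (negbTE qn0) /= eqSS size_poly_eq0.
rewrite /root hornerD hornerM hornerX hornerC.
have [-> | /q0 ->] := eqVneq x 0; first by rewrite mulr0 add0r oner_eq0.
by rewrite mul0r add0r oner_eq0.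
Qed.

Definition SL2_tuple (F : fieldType) (n : nat) (M : 'I_n -> 'M[F]_2)
    (dM : forall i, \det (M i) == 1) : SL2n F n :=
  [ffun i => exist (fun N : 'M[F]_2 => \det N == 1) (M i) (dM i)].

Lemma mats_tuple (F : fieldType) (n : nat) (M : 'I_n -> 'M[F]_2)
    (dM : forall i, \det (M i) == 1) i : mats (SL2_tuple dM) i = M i.
Proof. by rewrite /mats ffunE. Qed.

(** A polynomial that vanishes on the orbit restricts to a one-variable
    polynomial on the line through [D] with direction [N]; that polynomial
    vanishes off the origin, hence at the origin. *)
Lemma closure_limit (F : closedFieldType) (n : nat) (A D : SL2n F n)
    (N : 'I_n -> 'M[F]_2) :
  (forall s, s != 0 -> exists2 g, g \is a GRing.unit &
     forall i, mats D i + s *: N i = conjby g (mats A i)) ->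
  zariski_closure (conj_orbit A) D.
Proof.
move=> lim Z [[I ->] orbZ] p Ip /=.
pose v := mxvec (\matrix_(i < n) mxvec (N i)) 0.
have [q qE] := meval_line (coords D 0) v p.
have := horner_vanish0 (q := q); rewrite qE => H.
rewrite -[RHS]H => [|s s0].
  by apply: meval_eq => i; rewrite mul0r addr0.
have [g ug gA] := lim s s0.
have dC i : \det (conjby g (mats A i)) == 1 by rewrite det_conjby // det_mats.
have /orbZ/(_ _ Ip) <- : conj_orbit A (SL2_tuple dC).
  by apply/conj_orbitP; exists g => // i; rewrite mats_tuple.
rewrite qE; apply: meval_eq => k.
case/mxvec_indexP: k => i k; case/mxvec_indexP: k => a b.
have := mats_tuple dC i; rewrite -gA /mats => CE.
by rewrite /v /coords !mxvecE 3!mxE !mxvecE CE !mxE.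
Qed.

(** Conjugation by a diagonal matrix with entries [s] and 1, in the order
    suited to the triangular shape, multiplies the off-diagonal entry by [s];
    now let [s] tend to 0. *)
Lemma closure_diagonal (F : closedFieldType) (n : nat) (A D : SL2n F n)
    (a b c d : 'I_n -> F) (g : 'M[F]_2) :
  g \is a GRing.unit ->
  (forall i, conjby g (mats A i) = mx2 (a i) (b i) (c i) (d i)) ->
  (forall i, b i = 0) \/ (forall i, c i = 0) ->
  (forall i, mats D i = mx2 (a i) 0 0 (d i)) ->
  zariski_closure (conj_orbit A) D.
Proof.
move=> ug gA tri DE.
apply: (closure_limit (N := fun i => mx2 0 (b i) (c i) 0)) => s s0.
case: tri => e.
- have uh : mx2 1 0 0 s \is a GRing.unit.
    by rewrite unit_mx2 detmx2 mul1r mul0r subr0.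
  exists (mx2 1 0 0 s * g) => [|i]; first by rewrite unitrMl.
  rewrite -conjby_comp // gA; apply/esym/conjbyE => //.
  by rewrite DE e !mx2E; congr mx2; ring.
- have uh : mx2 s 0 0 1 \is a GRing.unit.
    by rewrite unit_mx2 detmx2 mulr1 mul0r subr0.
  exists (mx2 s 0 0 1 * g) => [|i]; first by rewrite unitrMl.
  rewrite -conjby_comp // gA; apply/esym/conjbyE => //.
  by rewrite DE e !mx2E; congr mx2; ring.
Qed.

Lemma same_tracesC (F : fieldType) (T : Type) (A B : T -> 'M[F]_2) :
  same_traces A B -> same_traces B A.
Proof. by case=> t1 t2 t3; split=> *; rewrite (t1, t2, t3). Qed.

Lemma conj_orbit_refl (F : closedFieldType) (n : nat) (A : SL2n F n) :
  conj_orbit A A.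
Proof.
apply/conj_orbitP; exists 1; rewrite ?unitr1 // => i.
by rewrite /conjby mul1r invr1 mulr1.
Qed.

(** * Closure-equivalence *)

Lemma closure_equivP (F : closedFieldType) (n : nat) (A B : SL2n F n) :
  closure_equiv A B <-> trn A = trn B.
Proof.
split=> [[C [/trn_closure <- /trn_closure //]] | AB].
have tAB := trn_same_traces AB.
have self (C : SL2n F n) := orbit_closure (conj_orbit_refl C).
have [triA | irrA] := pselect (triangularizable (mats A)); last first.
  have cAB := irreducible_conj (det_mats A) (det_mats B) tAB irrA.
  exists B; split; last exact: self.
  by apply: orbit_closure; apply/conj_orbitP.
have [triB | irrB] := pselect (triangularizable (mats B)); last first.
  have cBA :=
    irreducible_conj (det_mats B) (det_mats A) (same_tracesC tAB) irrB.
  exists A; split; first exact: self.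
  by apply: orbit_closure; apply/conj_orbitP.
have [a [d [ad [g ug [b gA]] [h uh hB]]]] :=
  triangularizable_common_diagonal (det_mats A) (det_mats B) tAB triA triB.
have dD i : \det (mx2 (a i) 0 0 (d i)) == 1 by rewrite detmx2 mul0r subr0 ad.
exists (SL2_tuple dD); split.
  by apply: (closure_diagonal ug gA); [right | exact: mats_tuple].
case: hB => [[b' hB] | [c hB]].
  by apply: (closure_diagonal uh hB); [right | exact: mats_tuple].
by apply: (closure_diagonal uh hB); [left | exact: mats_tuple].
Qed.

Lemma closure_classE (F : closedFieldType) (n : nat) (A : SL2n F n) :
  closure_class A = @trn F n @^-1` [set trn A].
Proof.
apply/seteqP; rewrite /closure_class.
by split=> B /=; [move/closure_equivP | move=> e; apply/closure_equivP].
Qed.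

Theorem theorem15 (F : closedFieldType) (n : nat) :
  [/\ RelationClasses.Equivalence (@closure_equiv F n),
      closure_classes F n =
        [set S | exists2 t : 'rV[F]_(trace_dim n),
                   S = @trn F n @^-1` [set t] & S !=set0] &
      exists phi : char_variety F n -> trn_image F n,
        (forall A : SL2n F n, \val (phi (char_of A)) = trn A) /\
        char_isomorphism phi].
Proof.
split.
- split; first by move=> A; exact/closure_equivP.
    by move=> A B /closure_equivP e; apply/closure_equivP.
  move=> A B C /closure_equivP e1 /closure_equivP e2.
  by apply/closure_equivP; rewrite e1.
- apply/seteqP; split=> S /=.
    by case=> A _ <-; exists (trn A); rewrite closure_classE //; exists A.
  by case=> t -> [A At]; exists A => //; rewrite closure_classE At.
have repr (x : char_variety F n) : {A | char_of A = x}.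
  apply: cid; case: x => S SX; have /set_mem[A _ AS] := SX.
  by exists A; apply: val_inj.
pose im (A : SL2n F n) : trn_image F n :=
  exist _ (trn A) (mem_set (imageT (@trn F n) A)).
have lift (y : trn_image F n) : {A | im A = y}.
  apply: cid; case: y => t tX; have /set_mem[A _ At] := tX.
  by exists A; apply: val_inj.
have char_ofP (A B : SL2n F n) : char_of A = char_of B <-> trn A = trn B.
  split=> [/(congr1 val)/= e | e].
    have : closure_class A B by rewrite e closure_classE.
    by rewrite closure_classE.
  by apply: val_inj; rewrite /= !closure_classE e.
pose phi x := im (projT1 (repr x)).
have phiE A : phi (char_of A) = im A.
  by apply: val_inj => /=; apply/char_ofP; case: (repr _).
exists phi; split=> [A|]; first by rewrite phiE.
split.
  exists (fun y => char_of (projT1 (lift y))) => [x|y].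
    case: (repr x) => A <-; rewrite phiE;
      case: (lift _) => B /= /(congr1 val)/= e.
    exact/char_ofP.
  by rewrite phiE; case: (lift y).
move=> f; split=> -[p pE]; exists p.
  by move=> A; rewrite /= phiE pE.
by move=> y; case: (lift y) => A <-; rewrite /= -pE /= phiE.
Qed.
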